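(* For every Borel probability measure $\mu$ on $\mathbf{R}$ we have $$\phi_\mu(z)=z^2\left[G_\mu(z)-\frac1z\right](1+o(1))$$ as $z\to\infty$ nontangentially.
   Context: For a Borel probability measure $\mu$ on $\mathbf{R}$ let $G_\mu(z)=\int_{-\infty}^\infty\frac{1}{z-t}\,d\mu(t)$ and $F_\mu(z)=1/G_\mu(z)$ for $z\in\mathbf{C}^+=\{\Im z>0\}$, so $F_\mu:\mathbf{C}^+\to\mathbf{C}^+$. For $\eta,M>0$ let $\Gamma_{\eta,M}=\{x+iy:y>M,\ |x|<\eta y\}$. For every $\eta>0$ there is $M>0$ such that $F_\mu$ has an analytic inverse $F_\mu^{-1}:\Gamma_{\eta,M}\to\mathbf{C}^+$, meaning $F_\mu(F_\mu^{-1}(z))=z$ and $F_\mu^{-1}(z)/z\to1$ as $z\to\infty$ in $\Gamma_{\eta,M}$; two such inverses agree on the intersection of their domains. The Voiculescu transform of $\mu$ is $\phi_\mu(z)=F_\mu^{-1}(z)-z$, defined on such truncated cones. ''$z\to\infty$ nontangentially'' means $|z|\to\infty$, $z\in\mathbf{C}^+$, with $\Re z/\Im z$ bounded, i.e. $z$ stays within a cone $\{x+iy:y>0,|x|<\eta y\}$ for some (arbitrary) $\eta>0$. Here $o(1)$ denotes a complex-valued function tending to $0$ in this sense. *)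

(* Defs.v *)
From HB Require Import structures.
From mathcomp Require Import all_boot all_order all_algebra.
From mathcomp Require Import complex.
From mathcomp Require Import all_classical all_reals all_analysis.

Set Implicit Arguments.
Unset Strict Implicit.
Unset Printing Implicit Defensive.

Import Order.TTheory GRing.Theory Num.Theory.
Import numFieldTopology.Exports numFieldNormedType.Exports.

Local Open Scope classical_set_scope.
Local Open Scope ring_scope.
Local Open Scope complex_scope.

(* The complex numbers with their usual topology (the one of the norm), as a
   normed module over themselves. *)
HB.instance Definition _ (R : rcfType) := NormedModule.copy R[i] R[i]^o.

Section Voiculescu.
Context {R : realType}.
Implicit Types (eta M : R) (z w : R[i]) (f H : R[i] -> R[i]).
Implicit Types mu : probability (measurableTypeR R) R.

Definition upper_half_plane : set R[i] := [set z | 0 < complex.Im z].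

Definition cone eta : set R[i] :=
  [set z | 0 < complex.Im z /\ `|complex.Re z| < eta * complex.Im z].

Definition truncated_cone eta M : set R[i] :=
  [set z | M < complex.Im z /\ `|complex.Re z| < eta * complex.Im z].

(* Neighbourhoods of infinity inside D: "z --> oo, z in D". *)
Definition infty_within (D : set R[i]) : set_system R[i] :=
  [set A | exists r : R, forall z, D z -> r%:C < `|z| -> A z].

Global Instance infty_within_filter (D : set R[i]) : Filter (infty_within D).
Proof.
split; first by exists 0.
- move=> A B [r rA] [s sB]; exists (Num.max r s) => z Dz rsz.
  by split; [apply: rA | apply: sB] => //; apply: le_lt_trans rsz;
    rewrite lecR le_max lexx ?orbT.
- by move=> A B AB [r rA]; exists r => z Dz rz; apply/AB/rA.
Qed.

Definition cauchy_transform mu z : R[i] :=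
  (\int[mu]_t complex.Re (z - t%:C)^-1) +i*
  (\int[mu]_t complex.Im (z - t%:C)^-1).

Definition reciprocal_cauchy_transform mu z : R[i] := (cauchy_transform mu z)^-1.

(* H is an analytic inverse of F_mu on Gamma_{eta,M}.  The values of H outside
   the (open) set Gamma_{eta,M} are irrelevant; analyticity is complex
   differentiability at each point of it. *)
Definition is_F_inverse mu eta M H :=
  [/\ forall z, truncated_cone eta M z -> upper_half_plane (H z),
      forall z, truncated_cone eta M z -> derivable H z 1,
      forall z, truncated_cone eta M z ->
        reciprocal_cauchy_transform mu (H z) = z
    & H z / z @[z --> infty_within (truncated_cone eta M)] --> (1 : R[i])].

(* phi_mu(z) = F_mu^{-1}(z) - z for any inverse whose truncated cone contains z
   (the inverses agree where they are both defined); the junk value 0 is taken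
   only if z belongs to no truncated cone carrying an inverse. *)
Definition voiculescu_transform mu z : R[i] :=
  xget 0 [set w | exists eta M H,
    [/\ 0 < eta, 0 < M, is_F_inverse mu eta M H, truncated_cone eta M z
      & w = H z - z]].

End Voiculescu.

(* Main.v *)
Require Import Defs.
From mathcomp Require Import all_boot all_order all_algebra.
From mathcomp Require Import complex.
From mathcomp Require Import all_classical all_reals all_analysis.
From mathcomp Require Import measurable_realfun ring lra.

Import Order.TTheory GRing.Theory Num.Theory.
Import numFieldTopology.Exports numFieldNormedType.Exports.

Local Open Scope classical_set_scope.
Local Open Scope ring_scope.
Local Open Scope complex_scope.

Local Notation Re := complex.Re.
Local Notation Im := complex.Im.
Local Notation normc := ComplexField.Normc.normc.

(** Write [q_z t = t / (z - t)], and let [a z] ([defect]) be the integral of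
    [q_z] and [b w z] ([mixed_defect]) the integral of the product [q_w q_z].
    Then [a z = z G(z) - 1], so that [F z = z / (1 + a z)] and
    [z ^ 2 (G(z) - 1 / z) = z a(z)].  Two facts carry the proof.

    - Algebra ([mixed_defectE]): [(z - w) b(w, z) = w a(w) - z a(z)].  Solving
      [F w = z] means solving [w = z (1 + a w)] ([reciprocal_eqP]), and for such
      a [w] the two relations combine into the exact identity
      [(w - z) (1 + a w + b(w, z)) = z a(z)] ([voiculescu_identity]).

    - Analysis ([defect_small]): on a sector, [a] and [b] tend to 0 at infinity,
      since there [q_z t] is at most a constant times [min 1 (|t| / |z|)], whose
      integral vanishes as [|z|] grows, by dominated convergence.

    If [w = F^-1 z], then [w - z] is the Voiculescu transform at [z], and the
    identity is the announced asymptotics with [1 + o(1)] equal to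
    [1 / (1 + a w + b(w, z))].

    It remains to know that the transform at [z] is given by a root [w] lying in
    a sector and of modulus comparable to [|z|].  This has two sides.  An inverse
    exists ([local_inverse_is_F_inverse]): the map [w -> z (1 + a w)] contracts
    the disc of radius [|z| / (2 k)] about [z], and the difference quotients of
    its fixed point have an explicit limit, in terms of [a] and [b].  Conversely,
    whichever inverse [H] on whichever truncated cone defines the transform at
    [z], the value [H z] lies in that disc ([F_inverse_near_solution]): along the
    ray [s z], [s >= 1], the continuous function [|H (s z) / (s z) - 1|] tends to
    0, and it cannot take a value between [1 / (8 k)] and [1 / (2 k)], because a
    root in the disc is automatically much closer to the centre. *)

(** * The real-valued modulus of a complex number *)

Section Modulus.
Context {R : realType}.
Implicit Types z w : R[i].

(** The norm of [R[i]] takes values in [R[i]] itself; inequalities are handled on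
    its real counterpart [normc]. *)
Lemma normCE z : `|z| = (normc z)%:C.
Proof. by []. Qed.

Lemma normc_ge0 z : 0 <= normc z.
Proof. by case: z => x y; rewrite /= sqrtr_ge0. Qed.

Lemma normcD z w : normc (z + w) <= normc z + normc w.
Proof. exact: le_normcD. Qed.

Lemma normcM z w : normc (z * w) = normc z * normc w.
Proof. exact: ComplexField.Normc.normcM. Qed.

Lemma normcN z : normc (- z) = normc z.
Proof. exact: normcN. Qed.

Lemma normcB z w : normc (z - w) = normc (w - z).
Proof. by rewrite -opprB normcN. Qed.

Lemma normcV z : normc z^-1 = (normc z)^-1.
Proof. exact: ComplexField.Normc.normcV. Qed.

Lemma normc_eq0 z : (normc z == 0) = (z == 0).
Proof.
apply/eqP/eqP => [|->]; first exact: ComplexField.Normc.eq0_normc.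
exact: ComplexField.Normc.normc0.
Qed.

Lemma normc_gt0 z : (0 < normc z) = (z != 0).
Proof. by rewrite lt_def normc_ge0 andbT normc_eq0. Qed.

Lemma normc_real (x : R) : normc x%:C = `|x|.
Proof. by rewrite /= expr0n addr0 sqrtr_sqr. Qed.

Lemma normc1 : normc (1 : R[i]) = 1.
Proof. exact: ComplexField.Normc.normc1. Qed.

Lemma normc0 : normc (0 : R[i]) = 0.
Proof. exact: ComplexField.Normc.normc0. Qed.

Lemma Re_le_normc z : `|Re z| <= normc z.
Proof. by case: z => x y /=; rewrite -sqrtr_sqr ler_wsqrtr// lerDl sqr_ge0. Qed.

Lemma Im_le_normc z : `|Im z| <= normc z.
Proof. by case: z => x y /=; rewrite -sqrtr_sqr ler_wsqrtr// lerDr sqr_ge0. Qed.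

Lemma normc_le_Re_Im z : normc z <= `|Re z| + `|Im z|.
Proof.
case: z => x y /=; rewrite -[leRHS]ger0_norm ?addr_ge0// -sqrtr_sqr ler_wsqrtr//.
rewrite sqrrD !real_normK ?num_real// lerD2r lerDl mulrn_wge0// mulr_ge0//.
Qed.

Lemma normc_distD z w : normc z - normc w <= normc (z + w).
Proof.
by rewrite lerBlDr -(normcN w); apply: le_trans (normcD _ _); rewrite addrK.
Qed.

Lemma normc_distB z w : normc z - normc w <= normc (z - w).
Proof. by rewrite -(normcN w) normc_distD. Qed.

Lemma complex_addE z w : z + w = (Re z + Re w) +i* (Im z + Im w).
Proof. by case: z; case: w. Qed.

Lemma complex_mulE z w :
  z * w = (Re z * Re w - Im z * Im w) +i* (Re z * Im w + Im z * Re w).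
Proof. by case: z; case: w. Qed.

End Modulus.

(** * Integrals of bounded complex functions *)

Section ComplexIntegral.
Context {R : realType} (mu : probability (measurableTypeR R) R).
Implicit Types (f g : R -> R[i]) (z w : R[i]).

Definition cintegral f : R[i] :=
  (\int[mu]_t Re (f t)) +i* (\int[mu]_t Im (f t)).

(** An algebra of integrable functions: every integrand below is a polynomial in
    resolvents, hence belongs to it. *)
Definition bounded_mfun f := [/\ measurable_fun setT (fun t => Re (f t)),
  measurable_fun setT (fun t => Im (f t))
  & exists B : R, forall t, normc (f t) <= B].

Lemma bounded_integrable (h : R -> R) : measurable_fun setT h ->
  (exists B, forall t, `|h t| <= B) ->
  mu.-integrable setT (EFin \o h).
Proof.
move=> mh [B hB]; apply: measurable_bounded_integrable => //.
  by rewrite (le_lt_trans (probability_le1 _ _))// ltry.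
exists B; split; first by rewrite num_real.
by move=> M BM t _ /=; apply: le_trans (hB t) (ltW BM).
Qed.

Lemma Re_integrable f : bounded_mfun f ->
  mu.-integrable setT (EFin \o (fun t => Re (f t))).
Proof.
move=> [mf _ [B fB]]; apply: bounded_integrable => //.
by exists B => t; apply: le_trans (fB t); exact: Re_le_normc.
Qed.

Lemma Im_integrable f : bounded_mfun f ->
  mu.-integrable setT (EFin \o (fun t => Im (f t))).
Proof.
move=> [_ mf [B fB]]; apply: bounded_integrable => //.
by exists B => t; apply: le_trans (fB t); exact: Im_le_normc.
Qed.

Lemma bounded_mfun_cst c : bounded_mfun (fun=> c).
Proof. by split=> //; exists (normc c). Qed.

Lemma bounded_mfunD f g : bounded_mfun f -> bounded_mfun g ->
  bounded_mfun (fun t => f t + g t).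
Proof.
move=> [rf jf [A fA]] [rg jg [B gB]]; split.
- under eq_fun do rewrite complex_addE /=.
  exact: measurable_funD.
- under eq_fun do rewrite complex_addE /=.
  exact: measurable_funD.
- by exists (A + B) => t; rewrite (le_trans (normcD _ _))// lerD.
Qed.

Lemma bounded_mfunM f g : bounded_mfun f -> bounded_mfun g ->
  bounded_mfun (fun t => f t * g t).
Proof.
move=> [rf jf [A fA]] [rg jg [B gB]]; split.
- under eq_fun do rewrite complex_mulE /=.
  by apply: measurable_funB; exact: measurable_funM.
- under eq_fun do rewrite complex_mulE /=.
  by apply: measurable_funD; exact: measurable_funM.
- by exists (A * B) => t; rewrite normcM ler_pM// normc_ge0.
Qed.

Lemma cintegralD f g : bounded_mfun f -> bounded_mfun g ->
  cintegral (fun t => f t + g t) = cintegral f + cintegral g.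
Proof.
move=> bf bg; rewrite [RHS]complex_addE /=; congr Complex.
- under eq_Rintegral do rewrite complex_addE /=.
  by rewrite RintegralD//; exact: Re_integrable.
- under eq_Rintegral do rewrite complex_addE /=.
  by rewrite RintegralD//; exact: Im_integrable.
Qed.

Lemma cintegralZ c f : bounded_mfun f ->
  cintegral (fun t => c * f t) = c * cintegral f.
Proof.
move=> bf; have iR := Re_integrable _ bf; have iI := Im_integrable _ bf.
have int_scale (a : R) (h : R -> R) : mu.-integrable setT (EFin \o h) ->
    mu.-integrable setT (EFin \o (fun t => a * h t)).
  by move=> ih; exact: (integrableZl measurableT a ih).
rewrite [RHS]complex_mulE /=; congr Complex.
- under eq_Rintegral do rewrite complex_mulE /=.
  by rewrite RintegralB//= ?RintegralZl//; exact: int_scale.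
- under eq_Rintegral do rewrite complex_mulE /=.
  by rewrite RintegralD//= ?RintegralZl//; exact: int_scale.
Qed.

Lemma cintegral_cst c : cintegral (fun=> c) = c.
Proof.
rewrite /cintegral !Rintegral_cst//= probability_setT /= !mulr1.
by case: c.
Qed.

(** The integral is defined componentwise, which costs the factor 2. *)
Lemma normc_cintegral_le f (h : R -> R) : bounded_mfun f ->
  mu.-integrable setT (EFin \o h) -> (forall t, normc (f t) <= h t) ->
  normc (cintegral f) <= 2 * \int[mu]_t h t.
Proof.
move=> bf ih fh; apply: le_trans (normc_le_Re_Im _) _.
rewrite mulr_natl mulr2n; apply: lerD => /=.
- apply: le_trans (le_normr_Rintegral _ (Re_integrable _ bf)) _ => //.
  apply: le_Rintegral => //; first exact: (integrable_norm (Re_integrable _ bf)).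
  by move=> t _; apply: le_trans (fh t); exact: Re_le_normc.
- apply: le_trans (le_normr_Rintegral _ (Im_integrable _ bf)) _ => //.
  apply: le_Rintegral => //; first exact: (integrable_norm (Im_integrable _ bf)).
  by move=> t _; apply: le_trans (fh t); exact: Im_le_normc.
Qed.

Lemma normc_cintegral_bound f (B : R) : bounded_mfun f ->
  (forall t, normc (f t) <= B) -> normc (cintegral f) <= 2 * B.
Proof.
move=> bf fB; have := normc_cintegral_le _ (cst B) bf _ fB.
rewrite Rintegral_cst//= probability_setT mulr1; apply.
by apply: bounded_integrable => //; exists `|B|.
Qed.

Definition resolvent z (t : R) : R[i] := (z - t%:C)^-1.

Lemma subC_neq0 z (t : R) : 0 < Im z -> z - t%:C != 0.
Proof.
move=> z0; apply/eqP => /(congr1 (@Im R)); case: z z0 => x y /= y0.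
by rewrite subr0 => y00; rewrite y00 ltxx in y0.
Qed.

Lemma Im_le_subC z (t : R) : Im z <= normc (z - t%:C).
Proof.
apply: le_trans (Im_le_normc _); rewrite (_ : Im (z - _) = Im z) ?ler_norm//.
by case: z => x y /=; rewrite subr0.
Qed.

Lemma normc_resolvent_le z t : 0 < Im z -> normc (resolvent z t) <= (Im z)^-1.
Proof.
move=> z0; rewrite /resolvent normcV lef_pV2 ?Im_le_subC// posrE//.
by apply: lt_le_trans (Im_le_subC _ _).
Qed.

Lemma bounded_mfun_resolvent z : 0 < Im z -> bounded_mfun (resolvent z).
Proof.
move=> z0; have den t : (Re z - t) ^+ 2 + (Im z) ^+ 2 != 0.
  by rewrite gt_eqF// ltr_wpDl ?sqr_ge0// exprn_gt0.
have cden : continuous (fun t : R => ((Re z - t) ^+ 2 + (Im z) ^+ 2)^-1).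
  move=> t; apply: cvgV => //; apply: cvgD; last exact: cvg_cst.
  apply: cvgM; apply: cvgB;
    by [exact: cvg_cst|exact: cvg_id].
split.
- rewrite (_ : (fun t => _) =
    (fun t => (Re z - t) * ((Re z - t) ^+ 2 + (Im z) ^+ 2)^-1)); last first.
    apply/funext => t; rewrite /resolvent; case: z {z0 den cden} => x y /=.
    by rewrite subr0.
  apply: continuous_measurable_fun => t; apply: cvgM; last exact: cden.
  by apply: cvgB; [exact: cvg_cst|exact: cvg_id].
- rewrite (_ : (fun t => _) =
    (fun t => - Im z * ((Re z - t) ^+ 2 + (Im z) ^+ 2)^-1)); last first.
    apply/funext => t; rewrite /resolvent; case: z {z0 den cden} => x y /=.
    by rewrite subr0 mulNr.
  apply: continuous_measurable_fun => t.
  by apply: cvgM; [exact: cvg_cst|exact: cden].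
- by exists (Im z)^-1 => t; exact: normc_resolvent_le.
Qed.

End ComplexIntegral.

(** * Smallness of the defects in a sector *)

Section Sector.
Context {R : realType} (mu : probability (measurableTypeR R) R).
Implicit Types (z w : R[i]) (t k r d : R).

(** This is [t / (z - t)], see [kernel_defectE], written so as to be visibly a
    polynomial in the resolvent. *)
Definition kernel_defect z t : R[i] := z * resolvent z t - 1.

Definition defect z : R[i] := z * cauchy_transform mu z - 1.

Definition mixed_defect w z : R[i] :=
  cintegral mu (fun t => kernel_defect w t * kernel_defect z t).

Lemma kernel_defectE z t : 0 < Im z ->
  kernel_defect z t = t%:C * resolvent z t.
Proof.
move=> z0; rewrite /kernel_defect /resolvent; have h := subC_neq0 z t z0.
by field.
Qed.

Lemma bounded_mfun_kernel_defect z : 0 < Im z ->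
  bounded_mfun (kernel_defect z).
Proof.
move=> z0; apply: bounded_mfunD; last exact: bounded_mfun_cst.
apply: bounded_mfunM; first exact: bounded_mfun_cst.
exact: bounded_mfun_resolvent.
Qed.

Lemma defectE z : 0 < Im z -> defect z = cintegral mu (kernel_defect z).
Proof.
move=> z0; have br := bounded_mfun_resolvent z z0.
rewrite /kernel_defect cintegralD ?cintegralZ ?cintegral_cst//.
- by apply: bounded_mfunM => //; exact: bounded_mfun_cst.
- exact: bounded_mfun_cst.
Qed.

(** Integrated form of the pointwise relation
    [(z - w) q_w q_z = w q_w - z q_z]. *)
Lemma mixed_defectE w z : 0 < Im w -> 0 < Im z ->
  (z - w) * mixed_defect w z = w * defect w - z * defect z.
Proof.
move=> w0 z0; have bw := bounded_mfun_kernel_defect w w0.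
have bz := bounded_mfun_kernel_defect z z0.
rewrite !defectE// /mixed_defect -cintegralZ; last exact: bounded_mfunM.
rewrite -mulNr -!cintegralZ// -cintegralD.
- congr cintegral; apply/funext => t.
  have hw := subC_neq0 w t w0; have hz := subC_neq0 z t z0.
  by rewrite /kernel_defect /resolvent; field; rewrite hz hw.
- by apply: bounded_mfunM => //; exact: bounded_mfun_cst.
- by apply: bounded_mfunM => //; exact: bounded_mfun_cst.
Qed.

(** Cones, described by the modulus: [|z - t| >= Im z >= |z| / k] for every real
    [t]. *)
Definition sector k : set R[i] := [set z | 0 < Im z /\ normc z <= k * Im z].

(** Both bounds come from the sector: [|z - t| >= |z| / k] gives [k |t| / r], and
    [|t| <= |z - t| + |z| <= (1 + k) |z - t|] gives 1. *)
Lemma normc_kernel_defect_le k r z t : sector k z -> 0 < r -> r <= normc z ->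
  normc (kernel_defect z t) <= (1 + k) * Num.min 1 (`|t| / r).
Proof.
move=> [z0 zk] r0 rz; rewrite kernel_defectE// normcM normc_real.
rewrite /resolvent normcV; set D := normc (z - t%:C).
have zD : Im z <= D by exact: Im_le_subC.
have D0 : 0 < D by apply: lt_le_trans zD.
have k0 : 0 < k by rewrite -(pmulr_lgt0 _ z0); lra.
have rkD : r <= k * D by rewrite (le_trans rz)// (le_trans zk)// ler_pM2l.
rewrite ler_pdivrMr// minC mulrAC minr_pMr; last by nra.
rewrite le_min; apply/andP; split.
  rewrite mulrA ler_pdivlMr// mulrC ler_wpM2r//; lra.
rewrite mulr1 mulrDl mul1r.
have -> : `|t| = normc (z - (z - t%:C)) by rewrite subKr normc_real.
apply: le_trans (normcD _ _) _; rewrite normcN addrC lerD2l.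
by rewrite (le_trans zk)// ler_pM2l.
Qed.

Lemma measurable_tail r : measurable_fun setT (fun t : R => Num.min 1 (`|t| / r)).
Proof.
by apply: measurable_minr => //; exact: measurable_funM.
Qed.

Lemma tail_bound r t : 0 < r -> `|Num.min 1 (`|t| / r)| <= 1.
Proof.
by move=> r0; rewrite ger0_norm ?ge_min ?lexx// le_min ler01 divr_ge0// ltW.
Qed.

Lemma tail_integrable r : 0 < r ->
  mu.-integrable setT (EFin \o (fun t : R => Num.min 1 (`|t| / r))).
Proof.
move=> r0; apply: bounded_integrable; first exact: measurable_tail.
by exists 1 => t; exact: tail_bound.
Qed.

(** Dominated convergence along integer radii: the integrand is at most 1 and
    tends to 0 pointwise. *)
Lemma tail_small d : 0 < d ->
  exists2 r, 0 < r & \int[mu]_t Num.min 1 (`|t| / r) < d.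
Proof.
move=> d0.
have [] := @dominated_convergence _ _ _ mu setT measurableT
  (fun n t => (Num.min 1 (`|t| / n.+1%:R))%:E) (cst 0%E) (cst 1%E).
- by move=> n; apply/measurable_EFinP; exact: measurable_tail.
- exact: measurable_cst.
- apply: aeW => t _ /=; apply: cvg_EFin; first exact: nearW.
  apply: (@squeeze_cvgr _ _ _ _ (cst 0) (fun n => `|t| * n.+1%:R^-1)).
  + by apply: nearW => n /=; rewrite ge_min le_min ler01 lexx orbT andbT divr_ge0.
  + exact: cvg_cst.
  + rewrite -[0](mulr0 `|t|); apply: cvgM; first exact: cvg_cst.
    exact: cvg_harmonic.
- exact: (finite_measure_integrable_cst mu 1).
- by apply: aeW => t n _ /=; rewrite lee_fin tail_bound.
move=> _ _; rewrite integral_cst// mul0e => /fine_cvgP[_].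
move=> /cvgrPdist_lt/(_ _ d0)[N _ /(_ N (leqnn N))] /=.
rewrite sub0r normrN => h; exists N.+1%:R => //.
by apply: le_lt_trans h; exact: ler_norm.
Qed.

Definition small_defects k d r := forall w z,
  sector k w -> sector k z -> r <= normc w -> r <= normc z ->
  normc (defect w) <= d /\ normc (mixed_defect w z) <= d.

(** One scalar integral controls both defects: in the product of two kernels, one
    factor is bounded by [1 + |k|] and the other supplies the small tail. *)
Lemma defect_small k d : 0 < d -> exists2 r, 0 < r & small_defects k d r.
Proof.
(* 2 is the componentwise loss and [(1 + |k|) ^ 2] the product of two kernel
   bounds. *)
move=> d0; pose c := 2 * (1 + `|k|) ^+ 2.
have c0 : 0 < c by rewrite mulr_gt0// exprn_gt0// ltr_pwDl.
have [r r0 hr] := tail_small (d / c) (divr_gt0 d0 c0).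
exists r => // w z sw sz rw rz.
set T := fun t : R => Num.min 1 (`|t| / r).
have iT a : mu.-integrable setT (EFin \o (fun t => a * T t)).
  by exact: (integrableZl measurableT a (tail_integrable r r0)).
have T0 t : 0 <= T t by rewrite le_min ler01 divr_ge0// ltW.
have T1 t : T t <= 1 by rewrite ge_min lexx.
have K0 : 0 <= `|k| by [].
have key (f : R -> R[i]) : bounded_mfun f ->
    (forall t, normc (f t) <= (1 + `|k|) ^+ 2 * T t) ->
    normc (cintegral mu f) <= d.
  move=> bf /(normc_cintegral_le mu _ _ bf (iT _))/le_trans; apply.
  rewrite RintegralZl//; last exact: tail_integrable.
  by rewrite mulrA mulrC -ler_pdivlMr// ltW.
have qle u t : sector k u -> r <= normc u ->
    normc (kernel_defect u t) <= (1 + `|k|) * T t.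
  move=> su ru; apply: le_trans (normc_kernel_defect_le k r u t su r0 ru) _.
  by apply: ler_wpM2r; [exact: T0|rewrite lerD2l ler_norm].
have [w0 _] := sw; have [z0 _] := sz; split.
  rewrite defectE//; apply: key => [|t]; first exact: bounded_mfun_kernel_defect.
  apply: le_trans (qle _ _ sw rw) _; rewrite ler_wpM2r// expr2 ler_peMl//; lra.
apply: key => [|t]; first by apply: bounded_mfunM; exact: bounded_mfun_kernel_defect.
rewrite normcM; apply: (@le_trans _ _ ((1 + `|k|) * T t * ((1 + `|k|) * 1))).
  apply: ler_pM; rewrite ?normc_ge0 ?qle//.
  by apply: le_trans (qle z t sz rz) _; rewrite ler_pM2l// ltr_pwDl.
by rewrite mulr1 mulrAC expr2.
Qed.

End Sector.

(** * Limits and fixed points in the complex plane *)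

Section ComplexLimits.
Context {R : realType}.

Lemma cvg_normcP {T} {F : set_system T} {FF : Filter F} (f : T -> R[i])
    (l : R[i]) :
  f @ F --> l <-> forall e : R, 0 < e -> \forall x \near F, normc (f x - l) < e.
Proof.
split=> [/cvgrPdist_lt fl e e0|fl].
  have := fl e%:C; rewrite ltcR => /(_ e0); apply: filterS => x.
  by rewrite normCE ltcR normcB.
apply/cvgrPdist_lt => -[e e']; rewrite ltcE /= => /andP[/eqP -> e0].
by apply: filterS (fl e e0) => x; rewrite normCE ltcR normcB.
Qed.

Lemma cvg_geometric_steps (u : R ^nat) (C : R) :
  (forall n, `|u n.+1 - u n| <= C * 2^-1 ^+ n) -> cvgn u.
Proof.
move=> uC; rewrite (_ : u = (fun n => u 0%N + series (telescope u) n)); last first.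
  by apply/funext => n; rewrite -eq_sum_telescope.
apply: is_cvgD; first exact: is_cvg_cst.
apply: normed_cvg; apply: (@series_le_cvg _ _ (geometric C 2^-1)) => //.
- by move=> n; apply: normr_ge0.
- by move=> n /=; apply: le_trans (uC n).
- by apply: is_cvg_geometric_series; rewrite ger0_norm// invf_lt1// ltr1n.
Qed.

(** The contraction principle on a closed disc; completeness is used only through
    that of the reals, for the real and imaginary parts of the iterates. *)
Lemma complex_fixed_point (T : R[i] -> R[i]) (z : R[i]) (rho : R) :
  0 <= rho ->
  (forall w, normc (w - z) <= rho -> normc (T w - z) <= rho) ->
  (forall v w, normc (v - z) <= rho -> normc (w - z) <= rho ->
     normc (T v - T w) <= 2^-1 * normc (v - w)) ->
  exists2 w, normc (w - z) <= rho & T w = w.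
Proof.
move=> rho0 Tdisc Tlip; pose u n := iter n T z.
have udisc n : normc (u n - z) <= rho.
  by elim: n => [|n /Tdisc//]; rewrite /u /= subrr normc0.
have step n : normc (u n.+1 - u n) <= rho * 2^-1 ^+ n.
  elim: n => [|n IH]; first by rewrite expr0 mulr1 (udisc 1%N).
  apply: le_trans (Tlip _ _ (udisc n.+1) (udisc n)) _.
  by rewrite exprS mulrCA ler_pM2l// invr_gt0.
have /cvg_ex[x ux] : cvgn (fun n => Re (u n)).
  apply: (@cvg_geometric_steps _ rho) => n.
  apply: le_trans (step n); apply: le_trans (Re_le_normc _).
  by rewrite complex_addE; case: (u n).
have /cvg_ex[y uy] : cvgn (fun n => Im (u n)).
  apply: (@cvg_geometric_steps _ rho) => n.
  apply: le_trans (step n); apply: le_trans (Im_le_normc _).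
  by rewrite complex_addE; case: (u n).
pose w := x +i* y.
have uw (e : R) : 0 < e -> \forall n \near \oo, normc (u n - w) < e.
  move=> e0; have e20 : 0 < e / 2 by rewrite divr_gt0.
  move/cvgrPdist_lt: ux => /(_ _ e20) ux; move/cvgrPdist_lt: uy => /(_ _ e20) uy.
  apply: filterS2 ux uy => n xn yn; rewrite normcB (splitr e).
  apply: le_lt_trans (normc_le_Re_Im _) _; move: xn yn; rewrite complex_addE /=.
  by case: (u n) => p q /= xn yn; exact: ltrD.
have wdisc : normc (w - z) <= rho.
  apply/ler_addgt0Pl => e /uw [N _ /(_ N (leqnn N))] /= uNe.
  rewrite -(subrK (u N) w) -addrA; apply: le_trans (normcD _ _) _.
  by apply: lerD => //; rewrite normcB ltW.
exists w => //; apply/eqP; rewrite -subr_eq0 -normc_eq0 eq_le normc_ge0 andbT.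
apply/ler_addgt0Pl => e e0; rewrite addr0.
have [N _ uN] := uw _ (divr_gt0 e0 (ltr0n R 2)).
have := uN N (leqnn N); have := uN N.+1 (leqnSn N) => /= h1 h0.
have h : normc (T w - u N.+1) <= 2^-1 * normc (w - u N) := Tlip _ _ wdisc (udisc N).
rewrite -(subrK (u N.+1) (T w)) -addrA; apply: le_trans (normcD _ _) _.
apply: le_trans (lerD h (ltW h1)) _; rewrite normcB; lra.
Qed.

End ComplexLimits.

(** Limit computations for complex functions are stated over an arbitrary numeric
    field, where they follow from the algebra of limits without unfolding [R[i]]. *)
Lemma slope_limit {K : numFieldType} {T : Type} {F : set_system T}
    {FF : Filter F} (p q : T -> K) (p0 q0 c : K) : 1 + (q0 + p0) / c != 0 ->
  p @ F --> p0 -> q @ F --> q0 ->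
  (1 + p x) / (1 + (q x + p x) / c) @[x --> F] --> (1 + p0) / (1 + (q0 + p0) / c).
Proof.
move=> d0 pp0 qq0; apply: cvgM; first by apply: cvgD => //; exact: cvg_cst.
apply: cvgV => //; apply: cvgD; first exact: cvg_cst.
by apply: cvgM; [exact: cvgD|exact: cvg_cst].
Qed.

Lemma dnbhs0_addr_cvg {K : numFieldType} (z : K) :
  (h + z) @[h --> (0 : K)^'] --> z.
Proof.
apply: cvg_within_filter; rewrite -{2}(add0r z).
by apply: cvgD; [exact: cvg_id|exact: cvg_cst].
Qed.

Lemma cvg_lipschitz {R : realType} {T : Type} {F : set_system T}
    {FF : Filter F} (C : R) (f g : T -> R[i]) (l m : R[i]) :
  f @ F --> l -> (\forall x \near F, normc (g x - m) <= C * normc (f x - l)) ->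
  g @ F --> m.
Proof.
move=> /cvg_normcP fl gC; apply/cvg_normcP => e e0.
have C0 : 0 < `|C| + 1 by rewrite ltr_wpDl.
have := fl _ (divr_gt0 e0 C0); apply: filterS2 gC => x gx fx.
apply: le_lt_trans gx _; move: fx; rewrite ltr_pdivlMr// mulrC.
apply: le_lt_trans; rewrite ler_wpM2r ?normc_ge0//.
by rewrite (le_trans (ler_norm _))// lerDl.
Qed.

Lemma derivable_cvg {K : numFieldType} (f : K -> K) (z : K) :
  derivable f z 1 -> f y @[y --> z] --> f z.
Proof.
by move=> /derivable1_diffP/differentiable_continuous.
Qed.

Lemma ratio_cvg {K : numFieldType} {T : Type} {F : set_system T}
    {FF : Filter F} (p q : T -> K) (p0 q0 : K) : q0 != 0 ->
  p @ F --> p0 -> q @ F --> q0 -> p x / q x - 1 @[x --> F] --> p0 / q0 - 1.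
Proof.
move=> q00 pp0 qq0; apply: cvgB; last exact: cvg_cst.
by apply: cvgM => //; exact: cvgV.
Qed.

(** * The equation F w = z *)

Section Equation.
Context {R : realType} (mu : probability (measurableTypeR R) R).
Implicit Types (z w : R[i]) (k d : R).

Let a := defect mu.
Let b := mixed_defect mu.
Let F := reciprocal_cauchy_transform mu.

Lemma upper_neq0 z : 0 < Im z -> z != 0.
Proof. by move=> z0; apply/eqP => z00; rewrite z00 ltxx in z0. Qed.

(** The fixed-point form of the equation, in which [z] enters only as a factor. *)
Lemma reciprocal_eqP w z : 0 < Im w -> 0 < Im z ->
  F w = z <-> w = z * (1 + a w).
Proof.
move=> w0 z0; have wn := upper_neq0 w w0; have zn := upper_neq0 z z0.
rewrite /F /reciprocal_cauchy_transform /a /defect addrC subrK.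
set g := cauchy_transform mu w; split=> [gz|wE].
  have gn : g != 0 by rewrite -invr_eq0 gz.
  by rewrite -gz; field.
apply: invr_inj; rewrite invrK; apply: (mulfI zn); rewrite divff//.
by apply: (mulfI wn); rewrite mulr1 mulrCA -wE.
Qed.

(** The defect is Lipschitz with a small constant: after division by [v], the
    factor of [w - v] is a sum of defects over [v]. *)
Lemma defect_sub v w : 0 < Im v -> 0 < Im w ->
  v * (a v - a w) = (w - v) * (b v w + a w).
Proof.
by move=> v0 w0; rewrite [RHS]mulrDr /a /b mixed_defectE//; ring.
Qed.

(** The relation [w - z = z a(w)] gives [(w - z) (1 + a w) = w a(w)], and [b(w, z)]
    replaces [w a(w)] by [z a(z)] at the cost of [(w - z) b(w, z)]. *)
Lemma voiculescu_identity w z : 0 < Im w -> 0 < Im z -> w = z * (1 + a w) ->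
  (w - z) * (1 + a w + b w z) = z ^+ 2 * (cauchy_transform mu z - z^-1).
Proof.
move=> w0 z0 wE; have zn := upper_neq0 z z0.
have -> : z ^+ 2 * (cauchy_transform mu z - z^-1) = z * a z.
  by rewrite /a /defect; field.
have wzE : w - z = z * a w by rewrite {1}wE; ring.
rewrite mulrDr -[X in _ + X]opprK -mulNr opprB mixed_defectE// -/a.
by rewrite mulrDr mulr1 {1}wzE; ring.
Qed.

(** The radius [|z| / (2 k)] is half of the lower bound [|z| / k] for [Im z], so the
    disc stays in the half-plane, in the sector of constant [4 k]. *)
Lemma sector_near k z w : 1 <= k -> sector k z ->
  normc (w - z) <= normc z / (2 * k) ->
  sector (4 * k) w /\ normc z / 2 <= normc w.
Proof.
move=> k1 [z0 zk] wz; have k0 : 0 < k by lra.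
have zn : 0 <= normc z := normc_ge0 z.
set e := normc z / (2 * k) in wz.
have eE : e * (2 * k) = normc z by rewrite /e; field; rewrite gt_eqF.
have e0 : 0 <= e by rewrite divr_ge0// mulr_ge0// ltW.
have Imw : Im z - e <= Im w.
  have := le_trans (Im_le_normc _) wz; rewrite ler_norml => /andP[+ _].
  by case: (w) (z) => p q [p' q'] /=; lra.
have Imz : 2 * e <= Im z by rewrite -(ler_pM2l k0); lra.
have eImw : e <= Im w by lra.
have wle : normc w <= normc z + e.
  by rewrite -(subrK z w) addrC; apply: le_trans (normcD _ _) _; rewrite lerD2l.
have wge : normc z - e <= normc w.
  have := normc_distB z w; rewrite normcB; lra.
have e2 : 2 * e <= normc z by rewrite -eE; nra.
have e1 : 0 < e.
  by rewrite /e divr_gt0 ?mulr_gt0// normc_gt0 upper_neq0.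
split; last by lra.
split; first by lra.
apply: le_trans wle _; nra.
Qed.

Section Inverse.
Variables (k r : R).
Hypotheses (k1 : 1 <= k) (r0 : 0 < r).
Hypothesis small : small_defects mu (4 * k) (8 * k)^-1 r.

(** The factor 2 keeps the disc about [z] outside the radius [r], beyond which the
    defects are small. *)
Definition far z := sector k z /\ 2 * r <= normc z.
Definition near_solution z w :=
  normc (w - z) <= normc z / (2 * k) /\ w = z * (1 + a w).

Lemma far_near z w : far z -> normc (w - z) <= normc z / (2 * k) ->
  [/\ sector (4 * k) w, 0 < Im w, r <= normc w & normc z / 2 <= normc w].
Proof.
move=> [sz rz] wz; have [sw wz2] := sector_near k z w k1 sz wz.
split=> //; [by case: sw | lra].
Qed.

Let d18 : (8 * k)^-1 <= 8^-1.
Proof.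
have h : 8 <= 8 * k by move: k1; lra.
have h0 : 0 < 8 * k by move: k1; lra.
by rewrite lef_pV2 ?posrE.
Qed.

(** The contraction factor: [|z / v| <= 2] and the defects sum to at most 1/4. *)
Lemma defect_lipschitz z v w : far z ->
  normc (v - z) <= normc z / (2 * k) -> normc (w - z) <= normc z / (2 * k) ->
  normc (z * (a v - a w)) <= 2^-1 * normc (v - w).
Proof.
move=> fz vz wz.
have [sv v0 rv zv] := far_near z v fz vz.
have [sw w0 rw zw] := far_near z w fz wz.
have [_ bvw] := small v w sv sw rv rw; have [aw _] := small w v sw sv rw rv.
have nv : 0 < normc v := lt_le_trans r0 rv.
rewrite -(ler_pM2l nv) -normcM mulrCA defect_sub// !normcM normcB.
have nz : normc z <= 2 * normc v by lra.
have nb : normc (b v w + a w) <= 4^-1.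
  by apply: le_trans (normcD _ _) _; move: d18; lra.
have h : normc z * normc (b v w + a w) <= 2 * normc v * 4^-1.
  by apply: ler_pM => //; exact: normc_ge0.
have := normc_ge0 (v - w); nra.
Qed.

Lemma near_solution_exists z : far z -> exists w, near_solution z w.
Proof.
move=> fz; have kge1 := k1; have kgt0 : 0 < 2 * k by lra.
have le8 : 2 * k <= 8 * k by lra.
have [|w wz|v w vz wz|w wz wE] :=
  complex_fixed_point (fun w => z * (1 + a w)) z (normc z / (2 * k)).
- by rewrite divr_ge0 ?normc_ge0// ltW.
- have [sw w0 rw zw] := far_near z w fz wz.
  have [aw _] := small w w sw sw rw rw.
  rewrite mulrDr mulr1 addrC addKr normcM ler_wpM2l ?normc_ge0//.
  by apply: le_trans aw _; rewrite lef_pV2 ?posrE//; apply: lt_le_trans le8.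
- have := defect_lipschitz z v w fz vz wz; congr (normc _ <= _); ring.
- by exists w.
Qed.

(** An exact formula for the difference of two solutions: it bounds the difference
    and identifies the derivative of the inverse. *)
Lemma near_solution_sub y z v w : far y -> far z ->
  near_solution y v -> near_solution z w ->
  (v - w) * (1 + (b w v + a v) / (1 + a w)) = (y - z) * (1 + a v).
Proof.
move=> fy fz [vy vE] [wz wE].
have [_ v0 _ _] := far_near y v fy vy; have [_ w0 _ _] := far_near z w fz wz.
have wn := upper_neq0 w w0.
have zn : z != 0 by apply: contraNneq wn => z00; rewrite wE z00 mul0r.
have an : 1 + a w != 0 by apply: contraNneq wn => an; rewrite wE an mulr0.
have h := defect_sub w v w0 v0.
have -> : (v - w) * (1 + (b w v + a v) / (1 + a w)) =
    (v - w) + (v - w) * (b w v + a v) / (1 + a w) by ring.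
have zE : z = w / (1 + a w) by rewrite {1}wE; field.
rewrite -h (mulrC w) -mulrA -zE {1}vE {1}wE; ring.
Qed.

(** With defects at most 1/8, the quotient is at most (1/4) / (7/8) <= 1/2. *)
Lemma slope_denominator y z v w : far y -> far z ->
  near_solution y v -> near_solution z w ->
  2^-1 <= normc (1 + (b w v + a v) / (1 + a w)).
Proof.
move=> fy fz [vy _] [wz _].
have [sv _ rv _] := far_near y v fy vy; have [sw _ rw _] := far_near z w fz wz.
have [aw bwv] := small w v sw sv rw rv; have [av _] := small v v sv sv rv rv.
have h1 : 7 / 8 <= normc (1 + a w).
  by have := normc_distD 1 (a w); rewrite normc1; move: d18; lra.
have h2 : normc (b w v + a v) <= 4^-1.
  by apply: le_trans (normcD _ _) _; move: d18; lra.
have h3 : normc ((b w v + a v) / (1 + a w)) <= 2^-1.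
  by rewrite normcM normcV ler_pdivrMr; lra.
have := normc_distD 1 ((b w v + a v) / (1 + a w)); rewrite normc1; lra.
Qed.

Lemma near_solution_lipschitz y z v w : far y -> far z ->
  near_solution y v -> near_solution z w ->
  normc (v - w) <= 4 * normc (y - z).
Proof.
move=> fy fz ny nz; have e := near_solution_sub y z v w fy fz ny nz.
have c2 := slope_denominator y z v w fy fz ny nz; have [vy _] := ny.
have [sv _ rv _] := far_near y v fy vy; have [av _] := small v v sv sv rv rv.
have h : normc (1 + a v) <= 2.
  by apply: le_trans (normcD _ _) _; rewrite normc1; move: d18; lra.
move/(congr1 (@normc R)): e; rewrite !normcM.
have := normc_ge0 (v - w); have := normc_ge0 (y - z); nra.
Qed.

End Inverse.
End Equation.

(** * The inverse defined by the fixed point, and its derivative *)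

Section InverseAnalytic.
Context {R : realType} (mu : probability (measurableTypeR R) R).
Implicit Types (z w v : R[i]).

Local Notation a := (defect mu).
Local Notation b := (mixed_defect mu).

(** The difference is [w - v] times the integral of [q_w r_w q_v], with
    [r_w = 1 / (w - t)]; that integral is bounded on a sector. *)
Lemma mixed_defect_lipschitz (K : R) v w : 0 <= K ->
  sector K v -> sector K w ->
  normc (b w v - b w w) <= 2 * ((1 + K) ^+ 2 / Im w) * normc (v - w).
Proof.
move=> K0 sv sw; have [v0 _] := sv; have [w0 _] := sw.
have bv := bounded_mfun_kernel_defect v v0.
have bw := bounded_mfun_kernel_defect w w0.
have br := bounded_mfun_resolvent w w0.
have bwr := bounded_mfunM _ _ bw br; have bwrv := bounded_mfunM _ _ bwr bv.
have -> : b w v - b w w = (w - v) *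
    cintegral mu (fun t => kernel_defect w t * resolvent w t * kernel_defect v t).
  rewrite -cintegralZ// -mulN1r /mixed_defect -cintegralZ; last exact: bounded_mfunM.
  rewrite -cintegralD; [|exact: bounded_mfunM|].
    congr cintegral; apply/funext => t.
    have hw := subC_neq0 w t w0; have hv := subC_neq0 v t v0.
    by rewrite /kernel_defect /resolvent; field; rewrite hw hv.
  by apply: bounded_mfunM; [exact: bounded_mfun_cst|exact: bounded_mfunM].
rewrite normcM normcB mulrC ler_wpM2r ?normc_ge0//.
apply: normc_cintegral_bound => // t.
have kb u : sector K u -> normc (kernel_defect u t) <= 1 + K.
  move=> su; have [u0 _] := su.
  have nu : 0 < normc u by rewrite normc_gt0 upper_neq0.
  apply: le_trans (normc_kernel_defect_le K _ u t su nu (lexx _)) _.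
  by rewrite ler_piMr ?addr_ge0// ge_min lexx.
rewrite !normcM expr2 mulrAC; apply: ler_pM; rewrite ?mulr_ge0 ?normc_ge0//.
  by apply: ler_pM; rewrite ?normc_ge0 ?kb.
exact: normc_resolvent_le.
Qed.

Variables (k r : R).
Hypotheses (k1 : 1 <= k) (r0 : 0 < r).
Hypothesis small : small_defects mu (4 * k) (8 * k)^-1 r.

Definition local_inverse z : R[i] := xget 0 (near_solution mu k z).

Lemma local_inverseP z : far k r z -> near_solution mu k z (local_inverse z).
Proof.
move=> fz; apply: xgetPex.
exact: (near_solution_exists mu k r k1 r0 small z fz).
Qed.

(** Continuity of the inverse and of the defects along it, for an arbitrary filter
    so that it applies to the punctured neighbourhoods of the derivative. *)
Section Limits.
Context {T : Type} {F : set_system T} {FF : Filter F} (f : T -> R[i]) (z : R[i]).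
Hypotheses (fz : far k r z) (farf : \forall x \near F, far k r (f x)).
Hypothesis (cf : f x @[x --> F] --> z).

Lemma local_inverse_cvg : local_inverse (f x) @[x --> F] --> local_inverse z.
Proof.
apply: (cvg_lipschitz 4 _ _ _ _ cf); apply: filterS farf => x fx.
exact: (near_solution_lipschitz mu k r k1 small (f x) z _ _ fx fz
  (local_inverseP _ fx) (local_inverseP _ fz)).
Qed.

Lemma defect_local_inverse_cvg :
  a (local_inverse (f x)) @[x --> F] --> a (local_inverse z).
Proof.
apply: (cvg_lipschitz r^-1 _ _ _ _ local_inverse_cvg); apply: filterS farf => x fx.
set v := local_inverse (f x); set w := local_inverse z.
have [sv v0 rv _] := far_near k r k1 _ v fx (local_inverseP _ fx).1.
have [sw w0 rw _] := far_near k r k1 _ w fz (local_inverseP _ fz).1.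
have [_ bvw] := small v w sv sw rv rw; have [aw _] := small w w sw sw rw rw.
have k81 : (8 * k)^-1 <= 2^-1.
  have h8 : 2 <= 8 * k by move: k1; lra.
  by rewrite lef_pV2 ?posrE//; apply: lt_le_trans h8.
have h1 : normc (b v w + a w) <= 1 by apply: le_trans (normcD _ _) _; lra.
rewrite mulrC ler_pdivlMr// mulrC.
apply: (@le_trans _ _ (normc v * normc (a v - a w))).
  by rewrite ler_wpM2r ?normc_ge0.
by rewrite -normcM defect_sub// normcM normcB ler_piMr ?normc_ge0.
Qed.

Lemma mixed_defect_local_inverse_cvg :
  b (local_inverse z) (local_inverse (f x)) @[x --> F] -->
  b (local_inverse z) (local_inverse z).
Proof.
pose C : R := 2 * ((1 + 4 * k) ^+ 2 / Im (local_inverse z)).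
apply: (cvg_lipschitz C _ _ _ _ local_inverse_cvg); apply: filterS farf => x fx.
have [sv v0 rv _] := far_near k r k1 _ _ fx (local_inverseP _ fx).1.
have [sw w0 rw _] := far_near k r k1 _ _ fz (local_inverseP _ fz).1.
by apply: mixed_defect_lipschitz => //; move: k1; lra.
Qed.

Lemma slope_cvg :
  (1 + a (local_inverse (f x))) /
    (1 + (b (local_inverse z) (local_inverse (f x)) + a (local_inverse (f x))) /
       (1 + a (local_inverse z))) @[x --> F] -->
  (1 + a (local_inverse z)) /
    (1 + (b (local_inverse z) (local_inverse z) + a (local_inverse z)) /
       (1 + a (local_inverse z))).
Proof.
have ca := defect_local_inverse_cvg; have cb := mixed_defect_local_inverse_cvg.
have d0 : 1 + (b (local_inverse z) (local_inverse z) + a (local_inverse z)) /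
    (1 + a (local_inverse z)) != 0.
  have := slope_denominator mu k r k1 small z z _ _ fz fz
    (local_inverseP _ fz) (local_inverseP _ fz).
  by rewrite -normc_gt0; apply: lt_le_trans; rewrite invr_gt0.
exact: (slope_limit _ _ _ _ _ d0 ca cb).
Qed.

End Limits.

Lemma local_inverse_derivable z : far k r z ->
  (\forall y \near z, far k r y) -> derivable local_inverse z 1.
Proof.
move=> fz nearz; apply/cvg_ex; eexists.
have cz : (h + z) @[h --> (0 : R[i])^'] --> z by exact: dnbhs0_addr_cvg.
have farz : \forall h \near (0 : R[i])^', far k r (h + z) by exact: (cz _ nearz).
apply: cvg_trans (slope_cvg _ _ fz farz cz).
apply: near_eq_cvg; near=> h => /=.
have h0 : h != 0 by near: h; exact: nbhs_dnbhs_neq.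
have fh : far k r (h + z) by near: h.
have e := near_solution_sub mu k r k1 _ z _ _ fh fz (local_inverseP _ fh)
  (local_inverseP _ fz).
have d := slope_denominator mu k r k1 small _ z _ _ fh fz (local_inverseP _ fh)
  (local_inverseP _ fz).
have {}d : 1 + (b (local_inverse z) (local_inverse (h + z)) +
  a (local_inverse (h + z))) / (1 + a (local_inverse z)) != 0.
  by rewrite -normc_gt0; apply: lt_le_trans d; rewrite invr_gt0.
rewrite addrK in e.
have -> : h *: (1 : R[i]) = h by exact: mulr1.
by apply: (mulIf d); rewrite mulfVK// -[RHS]mulrA e mulKf.
Unshelve. all: by end_near. Qed.

End InverseAnalytic.

(** * Cones *)

Section Cones.
Context {R : realType}.
Implicit Types (eta M r : R) (z : R[i]).

Lemma cone_sector eta z : cone eta z -> sector (1 + eta) z.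
Proof.
move=> [z0 zeta]; split=> //; apply: le_trans (normc_le_Re_Im z) _.
by rewrite mulrDl mul1r addrC (gtr0_norm z0) lerD2l ltW.
Qed.

Lemma truncated_cone_far eta r z : 0 < r ->
  truncated_cone eta (2 * r) z -> far (1 + eta) r z.
Proof.
move=> r0 [rz zeta]; have z0 : 0 < Im z by lra.
split; first exact: cone_sector.
by apply: le_trans (Im_le_normc z); rewrite gtr0_norm// ltW.
Qed.

Lemma cone_truncated_cone eta M z : 0 < eta -> 
  cone eta z -> (1 + eta) * M < normc z -> truncated_cone eta M z.
Proof.
move=> e0 cz Mz; have [z0 zeta] := cz; have [_ zk] := cone_sector eta z cz.
split=> //; have e1 : 0 < 1 + eta by lra.
by rewrite -(ltr_pM2l e1); apply: lt_le_trans zk.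
Qed.

Lemma near_normc z (e : R) : 0 < e -> \forall y \near z, normc (y - z) < e.
Proof.
by move=> e0; apply: ((@cvg_normcP R _ _ (nbhs_filter z) id z).1 cvg_id).
Qed.

Lemma truncated_cone_open eta M z : 0 < eta -> truncated_cone eta M z ->
  \forall y \near z, truncated_cone eta M y.
Proof.
move=> eta0 [Mz zeta].
have e1 : 0 < Im z - M by lra.
have e2 : 0 < (eta * Im z - `|Re z|) / (1 + eta) by rewrite divr_gt0; lra.
have := near_normc z _ e1; have := near_normc z _ e2.
apply: filterS2 => y; rewrite ltr_pdivlMr; last lra.
move=> y2 y1.
have hI : `|Im y - Im z| <= normc (y - z).
  by apply: le_trans (Im_le_normc _); rewrite complex_addE; case: (z).
have hR : `|Re y - Re z| <= normc (y - z).
  by apply: le_trans (Re_le_normc _); rewrite complex_addE; case: (z).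
have hI' : Im z - normc (y - z) <= Im y by move: hI; rewrite ler_norml; lra.
have hR' : `|Re y| <= `|Re z| + normc (y - z).
  by rewrite -[Re y](subrK (Re z)) addrC (le_trans (ler_normD _ _))// lerD2l.
split; first by lra.
by apply: le_lt_trans hR' _; nra.
Qed.

Lemma sectorZ k (s : R) z : 0 < s -> sector k z -> sector k (s%:C * z).
Proof.
move=> s0 [z0 zk]; split.
  by rewrite complex_mulE /= mul0r addr0 mulr_gt0.
rewrite normcM normc_real gtr0_norm// complex_mulE /= mul0r addr0.
by rewrite mulrCA ler_pM2l.
Qed.

Lemma truncated_coneZ eta M (s : R) z : 0 < M -> 1 <= s ->
  truncated_cone eta M z -> truncated_cone eta M (s%:C * z).
Proof.
move=> M0 s1 [Mz zeta]; have s0 : 0 < s by lra.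
rewrite /truncated_cone /= complex_mulE /= !mul0r subr0 addr0; split; first by nra.
by rewrite normrM gtr0_norm// mulrCA ltr_pM2l.
Qed.

End Cones.

(** * Inverses of F near infinity *)

Section Existence.
Context {R : realType} (mu : probability (measurableTypeR R) R).
Implicit Types (eta M k r : R) (z w : R[i]).

(** The ratio of the inverse to [z] is [1 + a w] with [w] its value, so it tends to 1
    because the defect does to 0. *)
Lemma local_inverse_is_F_inverse eta r : 0 < eta -> 0 < r ->
  small_defects mu (4 * (1 + eta)) (8 * (1 + eta))^-1 r ->
  is_F_inverse mu eta (2 * r) (local_inverse mu (1 + eta)).
Proof.
move=> eta0 r0 small; have k1 : 1 <= 1 + eta by lra.
have sol z (fz : far (1 + eta) r z) :=
  local_inverseP mu (1 + eta) r k1 r0 small z fz.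
split=> [z cz|z cz|z cz|].
- have fz := truncated_cone_far eta r z r0 cz.
  by have [] := far_near (1 + eta) r k1 z _ fz (sol z fz).1.
- have fz := truncated_cone_far eta r z r0 cz.
  apply: (local_inverse_derivable mu (1 + eta) r k1 r0 small z fz).
  have := truncated_cone_open eta (2 * r) z eta0 cz.
  by apply: filterS => y; exact: truncated_cone_far.
- have fz := truncated_cone_far eta r z r0 cz.
  have [_ w0 _ _] := far_near (1 + eta) r k1 z _ fz (sol z fz).1.
  by apply/reciprocal_eqP => //; [case: fz => [[]]|exact: (sol z fz).2].
- apply/cvg_normcP => e e0; have e20 : 0 < e / 2 by lra.
  have [r' r'0 small'] := defect_small mu (4 * (1 + eta)) _ e20.
  exists (2 * r') => z cz; rewrite normCE ltcR => rz.
  have fz := truncated_cone_far eta r z r0 cz.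
  have [wz wE] := sol z fz.
  have [sw w0 _ zw] := far_near (1 + eta) r k1 z _ fz wz.
  have rw : r' <= normc (local_inverse mu (1 + eta) z) by lra.
  have [aw _] := small' _ _ sw sw rw rw.
  have zn : z != 0 by rewrite -normc_gt0; lra.
  rewrite {1}wE mulrAC divff// mul1r addrC addKr; lra.
Qed.

Lemma ray_ratio_cvg (H : R[i] -> R[i]) z (s : R) : s != 0 -> z != 0 ->
  derivable H (s%:C * z) 1 ->
  normc (H (t%:C * z) / (t%:C * z) - 1) @[t --> s] -->
  normc (H (s%:C * z) / (s%:C * z) - 1).
Proof.
move=> s0 zn dH.
have cray : t%:C * z @[t --> s] --> s%:C * z.
  apply/cvg_normcP => e e0; have zn0 : 0 < normc z by rewrite normc_gt0.
  have /cvgrPdist_lt/(_ _ (divr_gt0 e0 zn0)) : id @ s --> s by exact: cvg_id.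
  apply: filterS => t /=; rewrite ltr_pdivlMr// distrC => h.
  by rewrite -mulrBl -rmorphB normcM normc_real.
have sz0 : s%:C * z != 0.
  by rewrite mulf_neq0// -normc_gt0 normc_real normr_gt0.
have cH : H (t%:C * z) @[t --> s] --> H (s%:C * z).
  exact: (cvg_comp _ _ cray (derivable_cvg _ _ dH)).
have c := (cvg_normcP _ _).1 (ratio_cvg _ _ _ _ sz0 cH cray).
apply/cvgrPdist_lt => e e0; apply: filterS (c _ _ e e0) => t.
set x := H (t%:C * z) / _ - 1; set y := H (s%:C * z) / _ - 1 => xy.
apply: le_lt_trans xy; rewrite distrC ler_norml.
have := normc_distB x y; have := normc_distB y x; rewrite (normcB y x); lra.
Qed.

(** The relative distance of [H (s z)] to [s z] is continuous in [s >= 1], small for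
    large [s], and avoids an interval: by the intermediate value theorem it is small
    down to [s = 1].  The cone of [H] enters only through its stability under
    dilation, so it may depend on [z]. *)
Lemma F_inverse_near_solution k r eta M H z : 1 <= k -> 0 < r ->
  small_defects mu (4 * k) (8 * k)^-1 r ->
  0 < M -> is_F_inverse mu eta M H -> far k r z -> truncated_cone eta M z ->
  near_solution mu k z (H z).
Proof.
move=> k1 r0 small M0 [Hup Hder HF Hlim] fz cz.
have zn : z != 0 by apply: upper_neq0; case: fz => [[]].
have k0 : 0 < k by lra.
pose g s := normc (H (s%:C * z) / (s%:C * z) - 1).
have cs s : 1 <= s -> truncated_cone eta M (s%:C * z).
  by move=> s1; exact: truncated_coneZ.
have fs s : 1 <= s -> far k r (s%:C * z).
  move=> s1; have s0 : 0 < s by lra.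
  have [sz rz] := fz; split; first exact: sectorZ.
  by rewrite normcM normc_real gtr0_norm//; have := normc_ge0 z; nra.
have ns s : 1 <= s -> s%:C * z != 0.
  by move=> s1; apply: upper_neq0; case: (fs s s1) => [[]].
have gE s : 1 <= s ->
    normc (H (s%:C * z) - s%:C * z) = g s * normc (s%:C * z).
  by move=> s1; rewrite /g -normcM mulrBl mul1r mulfVK// ns.
have sol s : 1 <= s -> g s <= (2 * k)^-1 ->
    near_solution mu k (s%:C * z) (H (s%:C * z)).
  move=> s1 gs; split.
    by rewrite gE// mulrC ler_wpM2l ?normc_ge0.
  apply/reciprocal_eqP; [exact: Hup (cs s s1)| |exact: HF (cs s s1)].
  by case: (fs s s1) => [[]].
have gap s : 1 <= s -> g s <= (2 * k)^-1 -> g s <= (8 * k)^-1.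
  move=> s1 gs; have [wz wE] := sol s s1 gs.
  have [sw w0 rw _] := far_near k r k1 _ _ (fs s s1) wz.
  have [aw _] := small _ _ sw sw rw rw.
  by rewrite /g {1}wE mulrAC divff ?ns// mul1r addrC addKr.
(* Any value strictly between the two bounds of [gap] would do. *)
pose v := (4 * k)^-1.
have v2 : v <= (2 * k)^-1 by rewrite lef_pV2 ?posrE ?mulr_gt0// ler_pM2r// ler_nat.
have v8 : (8 * k)^-1 < v by rewrite ltf_pV2 ?posrE ?mulr_gt0// ltr_pM2r// ltr_nat.
have v0 : 0 < v by rewrite invr_gt0 mulr_gt0.
have far_lt : exists2 S, 1 <= S & g S < v.
  move/cvg_normcP: Hlim => /(_ _ v0)[r' Hr'].
  pose S := 1 + `|r'| / normc z.
  have nz : 0 < normc z by rewrite normc_gt0.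
  have S1 : 1 <= S by rewrite lerDl divr_ge0// ltW.
  have S0 : 0 < S by lra.
  exists S => //; apply: Hr' => /=; first exact: cs.
  rewrite normCE ltcR normcM normc_real gtr0_norm// mulrDl mul1r divfK ?gt_eqF//.
  by apply: le_lt_trans (ler_norm r') _; rewrite ltrDr.
have g1 : g 1 <= v.
  rewrite leNgt; apply/negP => vg1; have [S S1 gS] := far_lt.
  have cg : {within `[1, S], continuous g}.
    apply: continuous_in_subspaceT => s; rewrite inE /= in_itv /= => /andP[s1 _].
    have sn : s != 0 by rewrite gt_eqF//; lra.
    exact: (ray_ratio_cvg H z s sn zn (Hder _ (cs s s1))).
  have [|s] := @IVT _ g 1 S v S1 cg.
    by rewrite ge_min le_max (ltW gS) (ltW vg1) orbT.
  rewrite in_itv /= => /andP[s1 _] gs.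
  by have := gap s s1; rewrite gs => /(_ v2); rewrite leNgt v8.
have := sol 1 (lexx 1) (le_trans g1 v2).
by rewrite (_ : 1%:C = 1)// mul1r.
Qed.

(** The local inverse shows that the set defining the transform is nonempty; the
    inverse that the choice operator picks may be another one, on another cone. *)
Lemma voiculescu_near_solution eta : 0 < eta -> exists2 r : R, 0 < r &
  forall z, cone eta z -> r <= normc z ->
    exists2 w, near_solution mu (1 + eta) z w & voiculescu_transform mu z = w - z.
Proof.
move=> eta0; have k1 : 1 <= 1 + eta by lra.
have k8 : 0 < (8 * (1 + eta))^-1 by rewrite invr_gt0; lra.
have [r r0 small] := defect_small mu (4 * (1 + eta)) _ k8.
have M0 : 0 < 2 * r by lra.
exists ((1 + eta) * (2 * r) + 1) => [|z cz rz]; first by nra.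
have tz : truncated_cone eta (2 * r) z by apply: cone_truncated_cone => //; lra.
have fz := truncated_cone_far eta r z r0 tz.
have Hinv := local_inverse_is_F_inverse eta r eta0 r0 small.
rewrite /voiculescu_transform; set A := (X in xget 0 X).
have : A (xget 0 A).
  by apply: xgetPex; exists (local_inverse mu (1 + eta) z - z), eta, (2 * r),
    (local_inverse mu (1 + eta)).
move=> [eta' [M' [H' [eta'0 M'0 H'inv tz' ->]]]]; exists (H' z) => //.
exact: (F_inverse_near_solution (1 + eta) r eta' M').
Qed.

End Existence.

(** * The asymptotics *)

Theorem proposition2p5 (R : realType)
    (mu : probability (measurableTypeR R) R) :
  exists o1 : R[i] -> R[i], forall eta : R, 0 < eta ->
    (o1 z @[z --> infty_within (cone eta)] --> (0 : R[i])) /\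
    (\forall z \near infty_within (cone eta),
       voiculescu_transform mu z =
         z ^+ 2 * (cauchy_transform mu z - z^-1) * (1 + o1 z)).
Proof.
(* When [A z = 0] the identity [main] forces [phi z = 0], which makes the value 0
   of [o1 z] correct there. *)
pose A z := z ^+ 2 * (cauchy_transform mu z - z^-1).
pose phi := voiculescu_transform mu.
pose o1 z := if A z == 0 then 0 else phi z / A z - 1.
exists o1 => eta eta0.
have main (d : R) : 0 < d -> d <= 4^-1 -> exists r : R, forall z, cone eta z ->
    r%:C < `|z| -> exists2 c, normc c <= 2 * d & phi z * (1 + c) = A z.
  move=> d0 d4; have [r r0 sol] := voiculescu_near_solution mu eta eta0.
  have [r' r'0 small] := defect_small mu (4 * (1 + eta)) d d0.
  have k1 : 1 <= 1 + eta by lra.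
  exists (r + 2 * r') => z cz; rewrite normCE ltcR => rz.
  have rz1 : r <= normc z by lra.
  have [w [wz wE] phiE] := sol z cz rz1.
  have sz := cone_sector eta z cz.
  have [sw wz2] := sector_near (1 + eta) z w k1 sz wz.
  have sz4 : sector (4 * (1 + eta)) z.
    by case: sz => z0 zk; split=> //; nra.
  have rw : r' <= normc w by lra.
  have rz' : r' <= normc z by lra.
  have [aw bwz] := small w z sw sz4 rw rz'.
  exists (defect mu w + mixed_defect mu w z).
    by apply: le_trans (normcD _ _) _; lra.
  rewrite /phi phiE addrA; apply: voiculescu_identity => //; first by case: sw.
  by case: sz.
split.
  apply/cvg_normcP => e e0; pose d := Num.min 4^-1 (e / 8).
  have d0 : 0 < d by rewrite lt_min invr_gt0 ltr0n divr_gt0.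
  have d4 : d <= 4^-1 by rewrite ge_min lexx.
  have de : d <= e / 8 by rewrite ge_min lexx orbT.
  have [r hr] := main d d0 d4; exists r => z cz rz.
  rewrite subr0 /o1; case: eqP => [_|/eqP An]; first by rewrite normc0.
  have [c c2 phiA] := hr z cz rz.
  have c1 : 2^-1 <= normc (1 + c) by have := normc_distD 1 c; rewrite normc1; lra.
  have phi0 : phi z != 0 by apply: contraNneq An => p0; rewrite -phiA p0 mul0r.
  have c0 : 1 + c != 0 by apply: contraNneq An => p0; rewrite -phiA p0 mulr0.
  have -> : phi z / A z - 1 = - c / (1 + c) by rewrite -phiA; field; rewrite phi0 c0.
  rewrite normcM normcN normcV ltr_pdivrMr; last by lra.
  by apply: le_lt_trans c2 _; nra.
have q0 : 0 < 4^-1 :> R by rewrite invr_gt0.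
have [r hr] := main 4^-1 q0 (lexx _); exists r => z cz rz.
have [c c2 phiA] := hr z cz rz; rewrite -/(phi z) -/(A z) /o1.
case: eqP => [A0|/eqP An]; last by field.
have c1 : 2^-1 <= normc (1 + c) by have := normc_distD 1 c; rewrite normc1; lra.
have c0 : 1 + c != 0 by rewrite -normc_gt0; lra.
by rewrite A0 mul0r; apply: (mulIf c0); rewrite phiA A0 mul0r.
Qed.
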